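(* Let $\mathsf H$ be either a proper non-locally finite subpseudovariety of $\mathsf{Ab}$, or the pseudovariety $\mathsf G$, or the pseudovariety $\mathsf G_p$ for some prime $p$. Then $\mathsf{DRH}$ is not completely $\kappa$-reducible.
   Context: $\mathsf G$, $\mathsf G_p$ and $\mathsf{Ab}$ are the pseudovarieties of all finite groups, all finite $p$-groups ($p$ prime), and all finite abelian groups, respectively. A pseudovariety $\mathsf V$ is locally finite if $\overline\Omega_A\mathsf V$ is finite for every finite alphabet $A$. For a pseudovariety of groups $\mathsf H$, $\mathsf{DRH}$ is the pseudovariety of all finite semigroups whose regular $\mathcal R$-classes are groups lying in $\mathsf H$. $\mathsf S$ is the pseudovariety of all finite semigroups. For a pseudovariety $\mathsf V$ and a finite alphabet $A$, $\overline\Omega_A\mathsf V$ is the free pro-$\mathsf V$ semigroup on $A$; elements of $\overline\Omega_A\mathsf S$ are called pseudowords. For $u,v\in\overline\Omega_A\mathsf S$, $u=_{\mathsf V}v$ means that $u,v$ have the same image under the natural projection $\overline\Omega_A\mathsf S\to\overline\Omega_A\mathsf V$. The implicit signature $\kappa=\{\_\cdot\_,\ \_^{\omega-1}\}$ consists of multiplication and the $(\omega-1)$-power, $x^{\omega-1}=\lim_n x^{n!-1}$. $\Omega^\kappa_A\mathsf S$ is the $\kappa$-subalgebra of $\overline\Omega_A\mathsf S$ generated by $A$; its elements are called $\kappa$-words. Let $X$ be a finite set of variables and $P$ a finite set of parameters, disjoint from $X$. A $\kappa$-equation is a formal expression $u=v$ with $u,v\in\Omega^\kappa_{X\cup P}\mathsf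 S$. Consider a finite system of $\kappa$-equations $\{u_i=v_i: i=1,\dots,n\}$, constraints given by a pair $(\varphi,\nu)$, where $\varphi:\overline\Omega_A\mathsf S\to S$ is a continuous homomorphism into a finite semigroup $S$ ($A$ a finite alphabet) and $\nu:X\to S$ is a function, and an evaluation of parameters $\mathrm{ev}:P\to\Omega^\kappa_A\mathsf S$. A solution modulo $\mathsf V$ of this system is a continuous homomorphism $\delta:\overline\Omega_{X\cup P}\mathsf S\to\overline\Omega_A\mathsf S$ such that $\delta(u_i)=_{\mathsf V}\delta(v_i)$ for all $i$, $\varphi(\delta(x))=\nu(x)$ for all $x\in X$, and $\delta(p)=\mathrm{ev}(p)$ for all $p\in P$. It is a solution in $\kappa$-words if $\delta(X\cup P)\subseteq\Omega^\kappa_A\mathsf S$. The pseudovariety $\mathsf V$ is completely $\kappa$-reducible if every finite system of $\kappa$-equations (with any constraints given by a pair $(\varphi,\nu)$, where $\varphi:\overline\Omega_A\mathsf S\to S$ is a continuous homomorphism into a finite semigroup $S$, $A$ is any finite alphabet and $\nu:X\to S$ is a function, and with any parameter evaluation $\mathrm{ev}:P\to\Omega^\kappa_A\mathsf S$) that has a solution modulo $\mathsf V$ also has a solution modulo $\mathsf V$ in $\kappa$-words. *)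

(* Defs.v *)
From HB Require Import structures.
From mathcomp Require Import all_boot fingroup pgroup.
From mathcomp Require Import all_classical topology.

Set Implicit Arguments.
Unset Strict Implicit.
Unset Printing Implicit Defensive.

Local Open Scope classical_set_scope.
Local Open Scope group_scope.

(* Finite semigroups up to isomorphism: nonempty, with carrier {0, ..., n-1}.
   Restricting the carriers keeps the class of all finite semigroups in the
   universe of the carriers of sets and topological spaces, which is needed to
   form projective limits over it; every class of finite semigroups below is
   invariant under isomorphism. *)
Record finSemigroupType := FinSemigroup {
  fsg_size : nat;
  fsg_gt0 : (0 < fsg_size)%N;
  fsg_mul : 'I_fsg_size -> 'I_fsg_size -> 'I_fsg_size;
  fsg_mulA : associative fsg_mul }.

Definition fsg_sort (S : finSemigroupType) : Type := 'I_(fsg_size S).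
Coercion fsg_sort : finSemigroupType >-> Sortclass.

HB.instance Definition _ (S : finSemigroupType) :=
  Finite.copy (fsg_sort S) 'I_(fsg_size S).
HB.instance Definition _ (S : finSemigroupType) :=
  isSemigroup.Build (fsg_sort S) (@fsg_mulA S).

(* [pv_prod] and [pv_nonempty] (with [pv_quo]) give closure under all finite
   direct products. *)
Record pseudovariety (V : set finSemigroupType) : Prop := Pseudovariety {
  pv_nonempty : V !=set0;
  pv_sub : forall (S T : finSemigroupType) (f : {multiplicative S -> T}),
    injective f -> V T -> V S;
  pv_quo : forall (S T : finSemigroupType) (f : {multiplicative S -> T}),
    range f = [set: T] -> V S -> V T;
  pv_prod : forall (S T W : finSemigroupType)
      (f : {multiplicative W -> (S * T)%type}),
    bijective f -> V S -> V T -> V W }.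

Definition isog_to (gT : finGroupType) (S : finSemigroupType) : Prop :=
  exists f : {multiplicative gT -> S}, bijective f.

Definition pvG : set finSemigroupType :=
  [set S | exists gT : finGroupType, isog_to gT S].

Definition pvAb : set finSemigroupType :=
  [set S | exists2 gT : finGroupType, isog_to gT S & abelian [set: gT]%SET].

Definition pvGp (p : nat) : set finSemigroupType :=
  [set S | exists2 gT : finGroupType, isog_to gT S & p.-group [set: gT]%SET].

(* The principal right ideal x S^1. *)
Definition right_ideal (S : semigroupType) (x : S) : set S :=
  [set y | y = x \/ exists s, y = x * s].

Definition Rclass (S : semigroupType) (x : S) : set S :=
  [set y | right_ideal y = right_ideal x].

Definition regular (S : semigroupType) (x : S) : Prop :=
  exists s, x * s * x = x.

(* Every regular R-class is a subsemigroup which is a group and lies in H;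
   the subsemigroup is presented as the image of an embedding. *)
Definition DRH (H : set finSemigroupType) : set finSemigroupType :=
  [set S : finSemigroupType | forall x : S, regular x ->
    exists (T : finSemigroupType) (f : {multiplicative T -> S}),
      [/\ pvG T, H T, injective f & range f = Rclass x]].

(* [proV A V] is the free pro-V semigroup on A, built as the projective limit
   of all A-labelled members of V (those generated by their labels are cofinal)
   with the label-preserving homomorphisms; equivalently, its elements are the
   A-ary implicit operations on V.  It carries the subspace topology from the
   product of the discrete semigroups.  The class of all finite semigroups
   is [set: finSemigroupType]. *)
Record labelled (A : finType) (V : set finSemigroupType) := Labelled {
  lab_sg :> finSemigroupType;
  lab_in : V lab_sg;
  lab : A -> lab_sg }.

Record proV (A : finType) (V : set finSemigroupType) := ProV {
  proV_fun :> forall i : labelled A V, i;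
  proV_compat : forall (i j : labelled A V) (f : {multiplicative i -> j}),
    f \o lab i = lab j -> f (proV_fun i) = proV_fun j }.

HB.instance Definition _ A V := gen_eqMixin (proV A V).
HB.instance Definition _ A V := gen_choiceMixin (proV A V).

Section FreeProV.
Variables (A : finType) (V : set finSemigroupType).

Lemma proV_eq (u v : proV A V) : (forall i, u i = v i) -> u = v.
Proof.
case: u v => [u hu] [v hv] /= uv.
have {}uv : u = v by exact: functional_extensionality_dep.
by case: _ / uv hv => hv; congr ProV; exact: Prop_irrelevance.
Qed.

Lemma mul_compat (u v : proV A V) (i j : labelled A V)
    (f : {multiplicative i -> j}) :
  f \o lab i = lab j -> f (u i * v i) = u j * v j.
Proof. by move=> fij; rewrite gmulfM !(proV_compat _ fij). Qed.

Definition proV_mul (u v : proV A V) : proV A V := ProV (@mul_compat u v).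

Lemma proV_mulA : associative proV_mul.
Proof. by move=> u v w; apply: proV_eq => i /=; exact: mulgA. Qed.

HB.instance Definition _ := isSemigroup.Build (proV A V) proV_mulA.

Definition coordinates (u : proV A V) :
  prod_topology (fun i : labelled A V => discrete_topology i) := u.

HB.instance Definition _ :=
  Topological.copy (proV A V) (initial_topology coordinates).

Lemma gen_compat (a : A) (i j : labelled A V) (f : {multiplicative i -> j}) :
  f \o lab i = lab j -> f (lab i a) = lab j a.
Proof. by move=> <-. Qed.

Definition gen (a : A) : proV A V :=
  @ProV A V (fun i => lab i a) (@gen_compat a).

End FreeProV.

Definition locally_finite (V : set finSemigroupType) : Prop :=
  forall A : finType, finite_set [set: proV A V].

Definition pseudoword (A : finType) := proV A [set: finSemigroupType].

Section Projection.
Variables (A : finType) (V : set finSemigroupType).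

Definition forget_in (i : labelled A V) : labelled A [set: finSemigroupType] :=
  Labelled I (lab i).

Lemma proj_compat (u : pseudoword A) (i j : labelled A V)
    (f : {multiplicative i -> j}) :
  f \o lab i = lab j -> f (u (forget_in i)) = u (forget_in j).
Proof. exact: (@proV_compat _ _ u (forget_in i) (forget_in j) f). Qed.

Definition natural_proj (u : pseudoword A) : proV A V :=
  ProV (@proj_compat u).

Definition eq_mod (u v : pseudoword A) : Prop :=
  natural_proj u = natural_proj v.

End Projection.

(* v = u^(omega-1), i.e., v = lim u^(n!-1).  For n = 0, 1 the exponent is 0
   and [iterop 0 *%g u u] is the irrelevant default value u. *)
Definition is_omega_pred (A : finType) (u v : pseudoword A) : Prop :=
  (fun n : nat => iterop n`!.-1 *%g u u) @ \oo --> v.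

Inductive kappa_word (A : finType) : set (pseudoword A) :=
| kappa_gen a : kappa_word (gen _ a)
| kappa_mul u v : kappa_word u -> kappa_word v -> kappa_word (u * v)
| kappa_pow u v : kappa_word u -> is_omega_pred u v -> kappa_word v.

(* The alphabet of a system with variables X and parameters P is the disjoint
   union X + P. *)
Definition solution_mod (V : set finSemigroupType) (X P A : finType) (n : nat)
    (u v : 'I_n -> pseudoword (X + P)%type)
    (S : finSemigroupType) (phi : {multiplicative pseudoword A -> S})
    (nu : X -> S) (ev : P -> pseudoword A)
    (delta : {multiplicative pseudoword (X + P)%type -> pseudoword A}) : Prop :=
  [/\ continuous delta,
      forall i, eq_mod V (delta (u i)) (delta (v i)),
      forall x, phi (delta (gen _ (inl x))) = nu x &
      forall p, delta (gen _ (inr p)) = ev p].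

Definition completely_kappa_reducible (V : set finSemigroupType) : Prop :=
  forall (X P A : finType) (n : nat) (u v : 'I_n -> pseudoword (X + P)%type)
    (S : finSemigroupType) (phi : {multiplicative pseudoword A -> S})
    (nu : X -> S) (ev : P -> pseudoword A),
  (forall i, kappa_word (u i) /\ kappa_word (v i)) ->
  continuous (phi : pseudoword A -> discrete_topology S) ->
  (forall p, kappa_word (ev p)) ->
  (exists delta, solution_mod V u v phi nu ev delta) ->
  exists2 delta, solution_mod V u v phi nu ev delta &
    forall y : (X + P)%type, kappa_word (delta (gen _ y)).

(* Main.v *)
Require Import Defs.
From HB Require Import structures.
From mathcomp Require Import all_boot all_algebra.
From mathcomp Require Import fingroup morphism perm quotient.
From mathcomp Require Import gproduct cyclic pgroup sylow hall.
From mathcomp Require Import ring.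
From mathcomp Require all_classical topology.

Set Implicit Arguments.
Unset Strict Implicit.
Unset Printing Implicit Defensive.

Import GRing.Theory Num.Theory.

Local Open Scope group_scope.

(** In each case a system is exhibited that has a solution modulo DRH in
    pseudowords but none in kappa-words.  Modulo finite groups, a kappa-word is
    just an element of a free group, so it is enough to find an equation that is
    solvable in profinite groups and not in free groups, and to transport it
    from H to DRH.

    The transport goes through idempotents.  Let e be an idempotent pseudoword
    that is a right multiple of a word containing all the letters.  In a member
    of DRH generated by the letters, the R-class of e is a group lying in H and
    left translation by e is a homomorphism into this group ([DRH_group],
    [translation_eval]).  Hence e u = e v holds modulo DRH as soon as u = v holds
    modulo H, and conversely the factor e cancels in groups.  So every equation
    u = v is replaced by p u = p v, with p a new variable.

    If H is G_p or a proper, not locally finite subpseudovariety of Ab, then H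
    contains elements of unbounded orders, whereas for some prime r and some k
    no order in H is divisible by r^(k+1) ([bounded_locally_finite],
    [full_torsion_pvAb]).  The equation x^(r^(k+1)) = a^(r^k) is then solvable
    modulo H, since r can be inverted modulo the part of an order that is prime
    to r; but a kappa-word over the letter a is an integral power of a, and
    r^(k+1) n = r^k has no integral solution ([root_not_kappa_reducible]).

    If H = G, the equation is x y x = y, that is, y inverts x by conjugation,
    with the constraint that x is mapped onto a 3-cycle s of Sym(Z/3), the
    letters being mapped to s and to a transposition t inverting s.  In a
    finite group mapping onto Sym(Z/3), Sylow theory and coprime action lift
    (s, t) to a pair satisfying the equation ([lift_inversion]).  In contrast,
    let the letters act on Z/N, for N odd, as z |-> 2 z and z |-> z + 1; this is
    a quotient of the affine group Z[1/2] x| Z, in which an element inverted by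
    conjugation is trivial, because 2^n is never -1
    ([kappa_word_inverted_trivial]).  So a solution in kappa-words sends x to
    the identity of Z/3, against the constraint.

    In both cases solutions are found for finitely many finite semigroups at a
    time, among words, and pass to pseudowords by compactness
    ([proV_compactness]). *)

(** * Lifting an inversion in finite groups *)

(** This is the projectivity of Z_p x| Z_2 among profinite groups, in finite
    terms.  By a Frattini argument t lifts to a 2-element y normalising a Sylow
    p-subgroup P of the preimage of <[s]>.  The action of <[y^2]> on P is
    coprime and t^2 centralises s, so that every element of <[s]> lifts to a
    fixed point c of y^2 in P.  On such fixed points y acts as an involution,
    and therefore inverts c^-1 c^y, which lies over f(c)^-2. *)
Lemma lift_inversion (gT rT : finGroupType) (G : {group gT})
    (f : {morphism G >-> rT}) (p : nat) (s t : rT) :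
  odd p -> p.-elt s -> 2.-elt t -> s ^ t = s^-1 ->
  s \in f @* G -> t \in f @* G ->
  exists x y, [/\ x \in G, y \in G, f x = s, f y = t & x ^ y = x^-1].
Proof.
move=> p_odd ps t2 st sG tG.
have p2' : 2 \in p^'.
  by rewrite !inE; apply: contraL p_odd => /eqP <-.
pose N := f @*^-1 <[s]>.
have sNG : N \subset G by exact: subsetIl.
have fN : f @* N = <[s]> by rewrite morphpreK ?cycle_subG.
have [P sylP] := Sylow_exists p N.
have [sPN pP _] := and3P sylP.
have sPG := subset_trans sPN sNG.
have fP : f @* P = <[s]>.
  have := morphim_pHall f sPG sylP; rewrite fN => /pHall_id; exact.
(* The Frattini argument; z adjusts the image of y0 n^-1, which is t only up to
   an element of <[s]>. *)
have [y [Gy nPy fy]] : exists y, [/\ y \in G, y \in 'N(P) & f y = t].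
  have /morphimP[y0 Gy0 _ ty0] := tG.
  have sylPy : p.-Sylow(N) (P :^ y0).
    suff <- : N :^ y0 = N by rewrite pHallJ2.
    by rewrite -morphpreJ // -ty0 -cycleJ st cycleV.
  have [n Nn Py] := Sylow_trans sylP sylPy.
  have Gn := subsetP sNG n Nn.
  have /morphimP[z Gz Pz fz] : f n \in f @* P.
    by rewrite fP -fN mem_morphim.
  exists (y0 * n^-1 * z); split; first by rewrite !groupM ?groupV.
    apply: groupM; last exact: subsetP (normG P) z Pz.
    by apply/normP; rewrite conjsgM Py conjsgK.
  by rewrite !morphM ?groupM ?groupV // morphV // -fz mulgKV.
wlog y2 : y Gy nPy fy / 2.-elt y.
  apply; last exact: (p_elt_constt 2 y); rewrite ?groupX //.
  by rewrite morph_constt // fy constt_p_elt.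
pose w := y ^+ 2; pose H := (P :&: 'ker f)%G.
have nPw : w \in 'N(P) by rewrite groupX.
have pow_s m : s ^+ m ^ t = s ^- m by rewrite conjXg st expVgn.
have s_odd : odd #[s].
  have /p_natP[k ->] := ps.
  by rewrite oddX p_odd orbT.
(* As s has odd order, it has the form (f r)^-2. *)
have [r Pr fr] : exists2 r, r \in P & f r ^- 2 = s.
  have : s ^- uphalf #[s] \in f @* P by rewrite fP groupV mem_cycle.
  case/morphimP=> r Gr Pr rE; exists r => //.
  rewrite -rE expVgn invgK -expgM muln2.
  by rewrite odd_uphalfK // expgS expg_order mulg1.
have Gr := subsetP sPG r Pr.
have sr : f r \in <[s]> by rewrite -fP mem_morphim.
(* Coprime action: the coset of r, fixed by w, contains a fixed point of w. *)
have [c /setIP[Pc cwc] fc] : exists2 c, c \in 'C_P(<[w]>) & f c = f r.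
  have sHP : H \subset P by exact: subsetIl.
  have nHw : <[w]> \subset 'N(H).
    rewrite cycle_subG; apply/normP; rewrite conjIg (normP nPw); congr (_ :&: _).
    by apply/normP; apply: subsetP (ker_norm f) _ _; exact: groupX.
  have nHP : P \subset 'N(H).
    by rewrite normsI ?normG // (subset_trans sPG) ?ker_norm.
  have co : coprime #|P| #|<[w]>|.
    have w2 : 2.-elt w by exact: p_eltX.
    have w2' : p^'.-elt w := pi_pnat w2 p2'.
    exact: pnat_coprime pP w2'.
  have cwr : coset H r \in 'C_(P / H)(<[w]> / H).
    have nHw1 : w \in 'N(H) by rewrite -cycle_subG.
    have nHr : r \in 'N(H) by exact: subsetP nHP r Pr.
    rewrite inE mem_quotient //= quotient_cycle // cent_cycle.
    apply/cent1P/commgP; rewrite -morphR //= coset_id // inE.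
    apply/andP; split; last first.
      apply/kerP; first by rewrite groupR ?groupX.
      rewrite morphR ?groupX // morphX // fy.
      have /cycleP[k ->] := sr; apply/eqP/conjg_fixP.
      by rewrite (conjgM _ t t) pow_s conjVg pow_s invgK.
    by rewrite commgEl groupM ?groupV // memJ_norm.
  have := coprime_quotient_cent sHP nHw co (pgroup_sol pP).
  move=> CE; move: cwr; rewrite -CE => /morphimP[c Nc cc rc]; exists c => //.
  have /setIP[Pc _] := cc; have Gc := subsetP sPG c Pc.
  have Nr : r \in 'N(H) by exact: subsetP nHP r Pr.
  have := introT (rcoset_kercosetP Nr Nc) rc.
  rewrite mem_rcoset => /setIP[_ /kerP].
  rewrite groupM ?groupV // morphM ?groupV // morphV // => /(_ isT) frc.
  by apply/esym/eqP; rewrite eq_mulgV1 frc.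
have Gc := subsetP sPG c Pc.
exists (c^-1 * c ^ y), y; split=> //.
- by rewrite groupM ?groupV ?groupJ.
- rewrite morphM ?groupV ?groupJ // morphV // morphJ // fc fy.
  have /cycleP[k rk] := sr.
  by rewrite {2}rk pow_s -rk -fr invMg.
rewrite conjMg conjVg [RHS]invMg invgK -conjgM; congr (_ * _).
by apply/conjg_fixP/commgP/cent1P; rewrite -cent_cycle.
Qed.

Import all_classical topology.

Local Open Scope classical_set_scope.
Local Open Scope group_scope.

(** * Evaluating pseudowords in finite groups *)

Definition mult_map (G K : magmaType) (f : G -> K)
    (fM : {morph f : x y / x * y >-> x * y}) : {multiplicative G -> K} :=
  HB.pack f (isMultiplicative.Build G K f fM).

Fact card_group_gt0 (gT : finGroupType) : (0 < #|gT|)%N.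
Proof. by apply/card_gt0P; exists 1. Qed.

(** Finite groups as members of [finSemigroupType], whose carriers are ordinals. *)
Section GroupCode.
Variable gT : finGroupType.

Definition code_mul (i j : 'I_#|gT|) : 'I_#|gT| :=
  enum_rank (enum_val i * enum_val j).

Fact code_mulA : associative code_mul.
Proof. by move=> i j k; rewrite /code_mul !enum_rankK mulgA. Qed.

Definition group_code : finSemigroupType :=
  FinSemigroup (card_group_gt0 gT) code_mulA.

Definition code_val (x : group_code) : gT := enum_val x.
Definition code_elt (x : gT) : group_code := enum_rank x.

Lemma code_eltK : cancel code_elt code_val.
Proof. exact: enum_rankK. Qed.

Lemma code_valK : cancel code_val code_elt.
Proof. exact: enum_valK. Qed.

Fact code_valM : {morph code_val : x y / x * y >-> x * y}.
Proof. by move=> x y; exact: enum_rankK. Qed.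

Fact code_eltM : {morph code_elt : x y / x * y >-> x * y}.
Proof. by move=> x y; rewrite -[RHS]code_valK code_valM !code_eltK. Qed.

HB.instance Definition _ :=
  isMultiplicative.Build _ _ code_val code_valM.
HB.instance Definition _ :=
  isMultiplicative.Build _ _ code_elt code_eltM.

Lemma isog_to_group_code : isog_to gT group_code.
Proof.
exists code_elt.
by exists code_val; [exact: code_eltK | exact: code_valK].
Qed.

End GroupCode.

Section GroupEvaluation.
Variables (A : finType) (gT : finGroupType) (V : set finSemigroupType).
Variable VgT : V (group_code gT).

Definition group_index (g : A -> gT) : labelled A V :=
  Labelled VgT (fun a => code_elt (g a)).

Definition group_eval (g : A -> gT) (u : proV A V) : gT :=
  code_val (u (group_index g)).

Lemma group_eval_gen g a : group_eval g (gen _ a) = g a.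
Proof. exact: code_eltK. Qed.

Lemma group_evalM g u v :
  group_eval g (u * v) = group_eval g u * group_eval g v.
Proof. exact: code_valM. Qed.

End GroupEvaluation.

(** Pseudowords commute with homomorphisms, being families compatible with
    them. *)
Lemma group_eval_hom (A : finType) (gT rT : finGroupType)
    (V : set finSemigroupType) (VgT : V (group_code gT))
    (VrT : V (group_code rT)) (f : {multiplicative gT -> rT})
    (g : A -> gT) (h : A -> rT) (u : proV A V) :
  (forall a, f (g a) = h a) -> f (group_eval VgT g u) = group_eval VrT h u.
Proof.
move=> fg; apply: (can_inj (@code_eltK rT)); rewrite code_valK.
pose F : {multiplicative group_code gT -> group_code rT} :=
  @code_elt rT \o f \o @code_val gT.
apply: (@proV_compat _ _ u (group_index VgT g) (group_index VrT h) F).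
by apply/funext => a /=; rewrite code_eltK fg.
Qed.

Notation pseudo_index := (@group_index _ _ [set: finSemigroupType] I).
Notation pseudo_eval := (@group_eval _ _ [set: finSemigroupType] I).

(** * Topology of the free pro-V semigroups *)

(** The coordinates are discrete: convergence is eventual equality at each of
    them. *)
Lemma cvg_proV (A : finType) (V : set finSemigroupType)
    (F : set_system (proV A V)) (u : proV A V) : Filter F ->
  F --> u <-> forall i, F [set v : proV A V | v i = u i].
Proof.
move=> FF; split=> [Fu i|Fu].
  pose pr : prod_topology (fun i : {classic labelled A V} => discrete_topology i)
    -> discrete_topology i := proj (i : {classic labelled A V}).
  apply: Fu; exists [set v : proV A V | v i = u i]; split=> //.
  exists (pr @^-1` [set u i]) => //.
  apply: open_comp; last exact: discrete_open.
  by move=> v _; exact: proj_continuous.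
move=> U [_ [[W oW <-] Wu] /filterS]; apply.
suff /(_ W) : (coordinates v @[v --> F]) --> coordinates u.
  by apply; exact: open_nbhs_nbhs.
apply/cvg_sup => i Z [_ [[C _ <-] Cu] /filterS]; apply.
suff: F [set v : proV A V | C (v i)] by [].
by apply: filterS (Fu i) => v /= ->.
Qed.

Lemma nbhs_proV (A : finType) V (u : proV A V) (i : labelled A V) :
  nbhs u [set v : proV A V | v i = u i].
Proof. exact: (cvg_proV u (nbhs_filter u)).1 cvg_id i. Qed.

Lemma proV_fun_continuous (A : finType) V (i : labelled A V) :
  continuous (fun u : proV A V => (u i : discrete_topology i)).
Proof.
move=> u; apply/(discrete_cvg (X := discrete_topology i)).
  by apply: fmap_filter; exact: nbhs_filter.
exact: nbhs_proV.
Qed.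

(** The (omega-1)-power is inversion in a group: the order of an element divides
    n! for n large. *)
Lemma group_eval_pred (A : finType) (gT : finGroupType) (g : A -> gT)
    (u v : pseudoword A) :
  is_omega_pred u v -> pseudo_eval g v = (pseudo_eval g u)^-1.
Proof.
move=> uv.
have [N _] := (cvg_proV v _).1 uv (pseudo_index g).
move=> /(_ (maxn N (maxn 2 #|gT|)) (leq_maxl _ _)) /=.
set n := maxn N _ => vE.
have powE m w : pseudo_eval g (iterop m.+1 *%g w w) = pseudo_eval g w ^+ m.+1.
  rewrite iteropS; elim: m => [|m IHm] //=.
  by rewrite group_evalM IHm -expgS.
have [k fn] : exists k, n`! = k.+2.
  have : (1 < n`!)%N.
    by apply: leq_trans (fact_geq n); rewrite /n !leq_max /= orbT.
  by case: n`! => [|[|k]] // _; exists k.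
apply: (mulgI (pseudo_eval g u)); rewrite mulgV.
have -> : pseudo_eval g v = pseudo_eval g u ^+ k.+1.
  by rewrite /group_eval -vE fn -/(pseudo_eval g _) powE.
rewrite -expgS -fn; apply/eqP; rewrite -order_dvdn.
apply: dvdn_fact; rewrite order_gt0 /n !leq_max /order.
by rewrite max_card !orbT.
Qed.

(** * Substitutions *)

(** The continuous homomorphism extending an arbitrary assignment of pseudowords
    to the letters: a coordinate of the image is the coordinate of the argument
    at the same semigroup, relabelled by the assignment. *)
Section Substitution.
Variables (A Y : finType) (w : Y -> pseudoword A).

Definition subst_index (i : labelled A [set: finSemigroupType]) :
  labelled Y [set: finSemigroupType] := @Labelled Y setT i I (fun y => w y i).

Lemma subst_compat (u : pseudoword Y) (i j : labelled A setT)
    (f : {multiplicative i -> j}) :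
  f \o lab i = lab j -> f (u (subst_index i)) = u (subst_index j).
Proof.
move=> fij; apply: (@proV_compat _ _ u (subst_index i) (subst_index j) f).
by apply/funext => y /=; exact: proV_compat.
Qed.

Definition subst (u : pseudoword Y) : pseudoword A := ProV (@subst_compat u).

Fact substM : {morph subst : u v / u * v}.
Proof. by move=> u v; exact: proV_eq. Qed.

HB.instance Definition _ := isMultiplicative.Build _ _ subst substM.

Lemma subst_gen y : subst (gen _ y) = w y.
Proof. exact: proV_eq. Qed.

Lemma subst_continuous : continuous subst.
Proof.
move=> u; apply/(cvg_proV _ (fmap_filter subst (nbhs_filter u))) => i.
exact: (nbhs_proV u (subst_index i)).
Qed.

End Substitution.

(** * Compactness *)

Lemma ultra_finite_value (J : Type) (U : set_system J) (T : finType)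
    (h : J -> T) : UltraFilter U -> exists z, U [set j | h j = z].
Proof.
move=> UU; apply: contrapT => /forallNP nU.
have UF : ProperFilter U by exact: ultra_proper.
have : \forall j \near U, forall z, h j <> z.
  apply: filter_forall => z.
  by case: (in_ultra_setVsetC [set j | h j = z] UU) => // /(nU z).
by case/filter_ex => j /(_ (h j)).
Qed.

(** The existence of the family w is a finitary matter, because each condition
    bears on one coordinate, where there are finitely many values.  Rather than
    Tychonoff's theorem, the proof takes a limit of approximate solutions along
    an ultrafilter on the finite sets of conditions that contains, for every
    condition, the finite sets to which it belongs. *)
Lemma proV_compactness (A X : finType) (V : set finSemigroupType) (I : Type)
    (c : I -> labelled A V) (Pr : forall i, (X -> c i) -> Prop) :
  (forall L : seq {classic I}, exists w : X -> proV A V,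
     forall i : I, (i : {classic I}) \in L -> Pr i (fun x => w x (c i))) ->
  exists w : X -> proV A V, forall i, Pr i (fun x => w x (c i)).
Proof.
move=> /choice[w wP].
pose F : set_system (seq {classic I}) :=
  filter_from setT
    (fun L : seq {classic I} => [set M : seq {classic I} | {subset L <= M}]).
have PF : ProperFilter F.
  apply: filter_from_proper; last by move=> L _; exists L => ?.
  apply: filter_from_filter; first by exists [::].
  move=> L M _ _; exists (L ++ M)%SEQ => // N LMN.
  by split=> i iL; apply: LMN; rewrite mem_cat iL ?orbT.
have [U [UU FU]] := ultraFilterLemma PF.
have UF : ProperFilter U by exact: ultra_proper.
pose lim_val x (i : labelled A V) : i :=
  sval (cid (@ultra_finite_value _ U _ (fun L => w L x i) UU)).
have limP x (i : labelled A V) : U [set L | w L x i = lim_val x i].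
  exact: (svalP (cid (@ultra_finite_value _ U _ (fun L => w L x i) UU))).
have lim_compat x (i j : labelled A V) (f : {multiplicative i -> j}) :
    f \o lab i = lab j -> f (lim_val x i) = lim_val x j.
  move=> fij; have [L [/= <- <-]] := filter_ex (filterI (limP x i) (limP x j)).
  exact: proV_compat.
exists (fun x => ProV (@lim_compat x)) => i.
have UL : U [set L : seq {classic I} | (i : {classic I}) \in L].
  by apply: FU; exists [:: (i : {classic I})] => // L; apply; exact: mem_head.
have UX : \forall L \near U, forall x, w L x (c i) = lim_val x (c i).
  by apply: filter_forall => x; exact: limP.
have [L [iL /= wL]] := filter_ex (filterI UL UX).
have := wP L i iL; congr (Pr i _).
by apply/funext => x.
Qed.

(** * Idempotents *)

(** A semigroup has no unit to start the powers from, so this is x^(n+1). *)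
Definition spow (S : semigroupType) (x : S) (n : nat) : S := iter n ( *%g x) x.

Lemma spowD (S : semigroupType) (x : S) m n :
  spow x m * spow x n = spow x (m + n).+1.
Proof. by elim: m => [|m IHm] //=; rewrite -mulgA IHm. Qed.

Lemma multiplicative_spow (S T : semigroupType) (f : {multiplicative S -> T})
    x n : f (spow x n) = spow (f x) n.
Proof. by elim: n => [|n IHn] //=; rewrite gmulfM IHn. Qed.

Lemma group_spow (gT : finGroupType) (x : gT) n : spow x n = x ^+ n.+1.
Proof. by elim: n => [|n IHn] //=; rewrite expgS -IHn. Qed.

Lemma proV_spow (A : finType) V (u : proV A V) (i : labelled A V) n :
  spow u n i = spow (u i) n.
Proof. by elim: n => [|n IHn] //=; rewrite -IHn. Qed.

(** The powers of x are ultimately periodic, and n! is a multiple of the period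
    that is beyond the preperiod. *)
Lemma spow_fact_idem (S : finSemigroupType) (x : S) n : (fsg_size S <= n)%N ->
  spow x n`!.-1 * spow x n`!.-1 = spow x n`!.-1.
Proof.
move=> Sn.
have [i [j [ij jS xij]]] :
    exists i j, [/\ (i < j)%N, (j <= fsg_size S)%N & spow x i = spow x j].
  apply: contrapT => noij.
  have inj : injective (fun i : 'I_(fsg_size S).+1 => spow x i).
    move=> i j /= xij; apply: ord_inj; apply: contrapT => nij; apply: noij.
    have [lt_ij|lt_ji|] := ltngtP i j; last by move/nij.
      by exists (i : nat), (j : nat); split=> //; exact: (ltn_ord j).
    by exists (j : nat), (i : nat); split=> //; exact: (ltn_ord i).
  by have := leq_card _ inj; rewrite !card_ord ltnn.
have period q k : spow x (i + k) = spow x (i + k + q * (j - i)).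
  have step m : spow x (i + m) = spow x (j + m).
    case: m => [|m]; first by rewrite !addn0.
    by rewrite !addnS -!spowD xij.
  elim: q => [|q ->]; first by rewrite addn0.
  rewrite -addnA step; congr spow.
  move: (j - i)%N (subnKC (ltnW ij)) => d <-.
  by rewrite mulSn -!addnA; congr addn; rewrite addnCA.
have iN : (i <= n`!.-1)%N.
  rewrite -ltnS prednK ?fact_gt0 //.
  by apply: leq_trans ij (leq_trans jS (leq_trans Sn (fact_geq n))).
have /dvdnP[q Nq] : (j - i %| n`!)%N.
  apply: dvdn_fact; rewrite subn_gt0 ij /=.
  exact: leq_trans (leq_subr _ _) (leq_trans jS Sn).
rewrite spowD -addnS prednK ?fact_gt0 // {2}Nq -(subnKC iN).
by rewrite -period.
Qed.

Definition idempotent_right_multiple (A : finType) V (e u : proV A V) : Prop :=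
  forall i, e i * e i = e i /\ exists z, e i = u i * z.

(** The pseudoword u^omega is such an e. *)
Lemma idempotent_multiple (A : finType) V (u : proV A V) :
  exists e : proV A V, idempotent_right_multiple e u.
Proof.
pose Pr (i : labelled A V) (w : unit -> i) :=
  w tt * w tt = w tt /\ exists z, w tt = u i * z.
suff [w wP] : exists w : unit -> proV A V, forall i, @Pr i (fun x => w x i).
  by exists (w tt).
apply: (proV_compactness (c := id)) => L.
have [n [n_gt1 Ln]] : exists n, (1 < n)%N /\
    forall i : labelled A V, (i : {classic labelled A V}) \in L -> (fsg_size i <= n)%N.
  elim: L => [|i L [n [n_gt1 Ln]]]; first by exists 2%N.
  exists (n + fsg_size i)%N; split=> [|j]; first exact: ltn_addr.
  rewrite inE => /orP[/eqP ->|/Ln]; first exact: leq_addl.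
  by move=> jn; apply: leq_trans jn (leq_addr _ _).
exists (fun=> spow u n`!.-1) => i /Ln iL; split.
  by rewrite proV_spow spow_fact_idem.
have : (1 < n`!)%N by exact: leq_trans (fact_geq n).
by case: n`! => [|[|m]] // _; exists (spow u m i).
Qed.

(** * Translation into the group of an idempotent *)

(** The R-class of an idempotent e, presented as a group in H with unit e.  The
    last clause says that it contains e x whenever e x is R-equivalent to e. *)
Lemma DRH_group (H : set finSemigroupType) (T : finSemigroupType) (e : T) :
  DRH H T -> e * e = e ->
  exists (gT : finGroupType) (F : {multiplicative gT -> T}),
    [/\ exists2 G, H G & isog_to gT G, injective F, F 1 = e &
        forall x z, e * x * z = e -> exists g, F g = e * x].
Proof.
move=> DT ee.
have [|T' [f [[gT [h hbij]] HT' f_inj fR]]] := DT e.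
  by exists e; rewrite ee ee.
have F_mul : {morph (f \o h) : x y / x * y} by move=> x y /=; rewrite !gmulfM.
have F_surj y : Rclass e y -> exists g, f (h g) = y.
  rewrite -fR => -[t _ <-]; case: hbij => h' _ hK.
  by exists (h' t); rewrite hK.
have F_inj : injective (f \o h) by exact: inj_comp f_inj (bij_inj hbij).
exists gT, (mult_map F_mul); split=> //=.
- by exists T' => //; exists h.
- have [g ge] := F_surj e erefl.
  rewrite -ge; congr (f (h _)); apply: (mulgI g); apply: F_inj.
  by rewrite mulg1 F_mul /= ge.
move=> x z exz; apply: F_surj; apply/seteqP; split=> y.
  by case=> [->|[s ->]]; right; [exists x | exists (x * s); rewrite mulgA].
case=> [->|[s ->]]; right; first by exists z.
by exists (z * s); rewrite mulgA exz.
Qed.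

(** The pseudowords that are finite words, that is, elements of the free
    semigroup. *)
Inductive letter_word (A : finType) V : set (proV A V) :=
| letter_word_gen a : letter_word (gen V a)
| letter_word_mul u v : letter_word u -> letter_word v -> letter_word (u * v).

Lemma letter_word_spow (A : finType) V (u : proV A V) n :
  letter_word u -> letter_word (spow u n).
Proof. by move=> uw; elim: n => [|n IHn] //=; exact: letter_word_mul. Qed.

(** Left translation by the idempotent F 1 is a homomorphism on words as soon as
    it sends the letters into the group F(gT): since F g = F 1 * u lies in the
    group, F 1 * u * v = (F 1 * u) * (F 1 * v). *)
Lemma translation_eval (A : finType) (i : labelled A [set: finSemigroupType])
    (gT : finGroupType) (F : {multiplicative gT -> i}) (g : A -> gT) :
  (forall a, F (g a) = F 1 * lab i a) ->
  forall u, letter_word u -> F (pseudo_eval g u) = F 1 * u i.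
Proof.
move=> Fg u; elim=> [a|{}u v _ IHu _ IHv]; first by rewrite group_eval_gen Fg.
by rewrite group_evalM gmulfM IHu IHv mulgA -IHu -gmulfM mulg1 IHu -mulgA.
Qed.

Lemma group_eval_spow (A : finType) (gT : finGroupType) (g : A -> gT) u n :
  pseudo_eval g (spow u n) = pseudo_eval g u ^+ n.+1.
Proof.
by rewrite -(group_spow (pseudo_eval g u)); elim: n => //= n <-; rewrite group_evalM.
Qed.

Lemma kappa_word_spow (A : finType) (u : pseudoword A) n :
  kappa_word u -> kappa_word (spow u n).
Proof. by move=> uk; elim: n => [|n IHn] //=; exact: kappa_mul. Qed.

(** * Solutions modulo DRH *)

(** A group is a single R-class. *)
Lemma DRH_group_code (H : set finSemigroupType) (gT : finGroupType) :
  H (group_code gT) -> DRH H (group_code gT).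
Proof.
move=> HgT x _; exists (group_code gT), idfun.
have [f [f' fK f'K]] := isog_to_group_code gT.
have divr y z : exists t : group_code gT, y = z * t.
  exists (f ((f' z)^-1 * f' y)).
  by rewrite -{1}[z]f'K -gmulfM mulKVg f'K.
split=> //; first by exists gT; exact: isog_to_group_code.
apply/seteqP; split=> y // _.
by apply/seteqP; split=> z _; right; exact: divr.
Qed.

Lemma eq_mod_group (H : set finSemigroupType) (A : finType)
    (gT : finGroupType) (g : A -> gT) u v :
  H (group_code gT) -> eq_mod (DRH H) u v -> pseudo_eval g u = pseudo_eval g v.
Proof.
move=> /DRH_group_code DgT uv.
pose i : labelled A (DRH H) := Labelled DgT (lab (pseudo_index g)).
by have /(congr1 (@code_val gT)) :=
   congr1 (fun w : proV A (DRH H) => w i) uv.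
Qed.

(** Reducibility for one equation, and for constraints saying that the solution
    in kappa-words agrees with the given one at the coordinate i0. *)
Lemma kappa_solution (V : set finSemigroupType) (X P A : finType)
    (u v : pseudoword (X + P)%type) (i0 : labelled A [set: finSemigroupType])
    (w : (X + P)%type -> pseudoword A) :
  completely_kappa_reducible V -> kappa_word u -> kappa_word v ->
  (forall p, kappa_word (w (inr p))) -> eq_mod V (subst w u) (subst w v) ->
  exists delta : {multiplicative pseudoword (X + P)%type -> pseudoword A},
    [/\ forall y, kappa_word (delta (gen _ y)),
        forall x, delta (gen _ (inl x)) i0 = w (inl x) i0,
        forall p, delta (gen _ (inr p)) = w (inr p) &
        eq_mod V (delta u) (delta v)].
Proof.
move=> red ku kv kw uv.
have phiM : {morph (fun t : pseudoword A => t i0) : s t / s * t} by [].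
have phi_cont := proV_fun_continuous (i := i0).
have [|delta [_ eq_uv phi_delta ev_delta] kdelta] :=
  red X P A 1%N (fun=> u) (fun=> v) i0 (mult_map phiM)
    (fun x => w (inl x) i0) (fun p => w (inr p)) (fun=> conj ku kv) phi_cont kw.
  exists (subst w); split=> //; first exact: subst_continuous.
    by move=> x; rewrite /= subst_gen.
by exists delta; split=> //; exact: eq_uv ord0.
Qed.

(** * Roots: an equation over one letter *)

(** A kappa-word over one letter is the power g^(d - c). *)
Lemma kappa_word_unit (u : pseudoword unit) : kappa_word u ->
  exists c d, forall (gT : finGroupType) (g : unit -> gT),
    pseudo_eval g u * g tt ^+ c = g tt ^+ d.
Proof.
elim=> [[]|{}u v _ [c [d ud]] _ [c' [d' vd]]|{}u v _ [c [d ud]] uv].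
- by exists 0%N, 1%N => gT g; rewrite group_eval_gen mulg1.
- exists (c' + c)%N, (d + d')%N => gT g.
  by rewrite group_evalM expgD -mulgA mulgA mulgA -(mulgA _ _ (_ ^+ c')) vd
    -mulgA -expgD addnC expgD mulgA ud expgD.
by exists d, c => gT g; rewrite (group_eval_pred _ uv) -(ud gT g) mulKg.
Qed.

(** D collects the parts prime to r of the numbers d i. *)
Lemma root_common_exponent (T : Type) (L : seq {classic T}) (d : T -> nat) r q :
  prime r -> (forall i, 0 < d i)%N -> (forall i, ~~ (r ^ q.+1 %| d i))%N ->
  exists D, coprime r D /\ forall i : T, (i : {classic T}) \in L ->
    (d i %| r ^ q * D)%N.
Proof.
move=> r_pr d_gt0 d_r; elim: L => [|j L [D [rD LD]]].
  by exists 1%N; rewrite coprimen1.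
exists (D * (d j)`_r^')%N; split=> [|i].
  rewrite coprimeMr rD /=.
  exact: pnat_coprime (pnat_id r_pr) (part_pnat _ (d j)).
rewrite inE => /orP[/eqP ->|/LD di]; last by rewrite mulnA dvdn_mulr.
rewrite mulnCA dvdn_mull // -[X in (X %| _)%N](partnC r (d_gt0 j)).
by rewrite dvdn_mul // p_part dvdn_exp2l // -ltnS ltnNge -pfactor_dvdn ?d_r.
Qed.

(** Modulo finitely many members of DRH, a power a^m solves the equation: with
    m r = 1 modulo D one has m r^(k+1) = r^k modulo r^k D, which is a multiple
    of the orders involved. *)
Lemma DRH_root_solution (H : set finSemigroupType) (r k : nat)
    (e : pseudoword unit) :
  prime r ->
  (forall (gT : finGroupType) G (g : gT),
     H G -> isog_to gT G -> ~~ (r ^ k.+1 %| #[g])%N) ->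
  idempotent_right_multiple e (gen _ tt) ->
  exists x : pseudoword unit, eq_mod (DRH H)
    (e * spow x (r ^ k.+1).-1) (e * spow (gen _ tt) (r ^ k).-1).
Proof.
move=> r_pr H_r eP.
set q := (r ^ k)%N.
have q_gt0 : (0 < q)%N by rewrite expn_gt0 prime_gt0.
pose Pr (i : labelled unit (DRH H)) (w : unit -> forget_in i) :=
  e (forget_in i) * spow (w tt) (r ^ k.+1).-1 =
  e (forget_in i) * spow (lab i tt) q.-1.
suff [w wP] : exists w : unit -> pseudoword unit,
    forall i : labelled unit (DRH H), Pr i (fun x => w x (forget_in i)).
  exists (w tt); apply: proV_eq => i.
  by rewrite /= !proV_spow; exact: wP i.
apply: (@proV_compactness _ _ _ _ (@forget_in unit (DRH H)) Pr) => L.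
have /choice[d dP] : forall i : labelled unit (DRH H), exists d : nat,
    [/\ (0 < d)%N, ~~ (r ^ k.+1 %| d)%N &
      exists (gT : finGroupType) (F : {multiplicative gT -> i}) (g : gT),
      [/\ #[g] = d, F 1 = e (forget_in i) &
          F g = e (forget_in i) * lab i tt]].
  move=> i; have [ee [z ez]] := eP (forget_in i).
  have [gT [F [[G HG gTG] F_inj F1 FR]]] := DRH_group (lab_in i) ee.
  have [|g Fg] := FR (lab i tt) z; first by rewrite -mulgA -[X in _ * X]ez ee.
  by exists #[g]; split; [exact: order_gt0|exact: H_r HG gTG|exists gT, F, g].
have [D [rD LD]] : exists D, coprime r D /\
    forall i : labelled unit (DRH H), (i : {classic _}) \in L -> (d i %| q * D)%N.
  by apply: root_common_exponent => // i; have [] := dP i.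
(* m inverts r modulo D *)
case: (egcdnP D (prime_gt0 r_pr)) => m t mr _.
rewrite (eqP rD) in mr.
have m_gt0 : (0 < m)%N by case: m mr => //; rewrite addn1.
pose x : pseudoword unit := spow (gen _ tt) m.-1.
exists (fun=> x) => i /LD.
have [_ _ [gT [F [g [<- F1 Fg]]]]] := dP i.
rewrite /Pr => dg.
have Fev := translation_eval (i := forget_in i) (F := F) (g := fun=> g).
have FR : forall a : unit, F g = F 1 * lab (forget_in i) a by case; rewrite F1.
have xw : letter_word x by apply: letter_word_spow; exact: letter_word_gen.
have /esym := Fev FR _ (letter_word_spow (r ^ k.+1).-1 xw).
rewrite proV_spow F1 => ->.
have aw : letter_word (gen setT tt) by exact: letter_word_gen.
have /esym := Fev FR _ (letter_word_spow q.-1 aw).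
rewrite proV_spow F1 => ->.
rewrite !group_eval_spow !group_eval_gen !prednK ?expn_gt0 ?(prime_gt0 r_pr) //.
rewrite -expgM; congr (F _); apply/eqP.
rewrite eq_expg_mod_order expnS mulnA mr mulnDl mul1n -/q.
rewrite -mulnA (mulnC D) -modnDml.
by move/(dvdn_mull t)/eqP: dg => ->; rewrite add0n.
Qed.

(** In a solution in kappa-words, x is a power a^(d - c), so that in groups of H
    r^(k+1) (d - c) = r^k modulo arbitrarily large orders, hence in the
    integers. *)
Theorem root_not_kappa_reducible (H : set finSemigroupType) (r k : nat) :
  prime r ->
  (forall (gT : finGroupType) G (g : gT),
     H G -> isog_to gT G -> ~~ (r ^ k.+1 %| #[g])%N) ->
  (forall M, exists (gT : finGroupType) (g : gT),
     H (group_code gT) /\ (M < #[g])%N) ->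
  ~ completely_kappa_reducible (DRH H).
Proof.
move=> r_pr H_r H_unb red.
have [e eP] := idempotent_multiple (gen [set: finSemigroupType] tt).
have [x xP] := DRH_root_solution r_pr H_r eP.
set q := (r ^ k)%N in xP.
have q_gt0 : (0 < q)%N by rewrite expn_gt0 prime_gt0.
pose Y := (bool + unit)%type.
pose w (y : Y) := match y with
  | inl true => e | inl false => x | inr tt => gen _ tt end.
pose yg (y : Y) : pseudoword Y := gen _ y.
pose u := yg (inl true) * spow (yg (inl false)) (r ^ k.+1).-1.
pose v := yg (inl true) * spow (yg (inr tt)) q.-1.
have ku : kappa_word u.
  by apply: kappa_mul; [|apply: kappa_word_spow]; exact: kappa_gen.
have kv : kappa_word v.
  by apply: kappa_mul; [|apply: kappa_word_spow]; exact: kappa_gen.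
have kw p : kappa_word (w (inr p)) by case: p; exact: kappa_gen.
have wuv : eq_mod (DRH H) (subst w u) (subst w v).
  rewrite /u /v !substM !multiplicative_spow /= !subst_gen.
  exact: xP.
(* The constraint is void; any coordinate will do. *)
have [delta [kd _ dg]] :=
  kappa_solution (pseudo_index (fun=> 1 : {perm bool})) red ku kv kw wuv.
rewrite /u /v !gmulfM !multiplicative_spow dg /=.
have [c [d xcd]] := kappa_word_unit (kd (inl false)).
have [gT [g [HgT g_ord]]] := H_unb (q + c * (r * q) + d * (r * q))%N.
move=> /(eq_mod_group (fun=> g) HgT); rewrite !group_evalM => /mulgI.
rewrite !group_eval_spow group_eval_gen !prednK ?expn_gt0 ?(prime_gt0 r_pr) //.
move: (xcd gT (fun=> g)); set z := pseudo_eval _ _ => zg zq.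
have zgc : commute z (g ^+ c).
  have -> : z = g ^+ d * (g ^+ c)^-1 by rewrite -zg mulgK.
  apply/commute_sym/commuteM; first exact: commuteX2.
  by apply: commuteV; exact: commuteX2.
have : g ^+ (q + c * (r * q)) == g ^+ (d * (r * q)).
  by rewrite expgD -zq expnS -/q [in X in _ * X]expgM -expgMn // zg -expgM.
rewrite eq_expg_mod_order !modn_small; first last.
- by apply: leq_ltn_trans g_ord; rewrite leq_addr.
- by apply: leq_ltn_trans g_ord; rewrite leq_addl.
rewrite -[X in (X + _)%N]mul1n !mulnA -mulnDl eqn_pmul2r // => /eqP r1.
have : (r %| 1)%N by rewrite -(dvdn_addl _ (dvdn_mull c (dvdnn r))) r1 dvdn_mull.
by rewrite dvdn1 => /eqP r1'; rewrite r1' in r_pr.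
Qed.

(** * Pseudovarieties of abelian groups *)

Lemma isog_to_card (gT : finGroupType) (S : finSemigroupType) :
  isog_to gT S -> #|gT| = fsg_size S.
Proof. by move=> [f /bij_eq_card ->]; exact: card_ord. Qed.

Lemma pvAb_abelian (gT : finGroupType) (S : finSemigroupType) :
  pvAb S -> isog_to gT S -> commutative (@mulg gT).
Proof.
move=> [rT [h [h' hK h'K]] cT] [f f_bij] x y; apply: (bij_inj f_bij).
rewrite !gmulfM -[f x]h'K -[f y]h'K -!gmulfM; congr (h _).
by apply: (centsP cT); exact: finset.in_setT.
Qed.

Section GroupsOfPseudovariety.
Variable H : set finSemigroupType.
Hypothesis pvH : pseudovariety H.

Lemma pv_isog (gT : finGroupType) S : H S -> isog_to gT S -> H (group_code gT).
Proof.
move=> HS [f f_bij].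
pose F : {multiplicative group_code gT -> S} := f \o @code_val gT.
apply: (pv_sub pvH (f := F)) HS.
exact: inj_comp (bij_inj f_bij) (can_inj (@code_valK gT)).
Qed.

Lemma pv_isog_code (gT : finGroupType) S :
  H (group_code gT) -> isog_to gT S -> H S.
Proof.
move=> HgT [f [f' fK f'K]].
have f'M : {morph f' : x y / x * y >-> x * y}.
  by move=> x y; rewrite -{1}[x]f'K -{1}[y]f'K -gmulfM fK.
pose F : {multiplicative S -> group_code gT} := @code_elt gT \o mult_map f'M.
apply: (pv_sub pvH (f := F)) HgT.
exact: inj_comp (can_inj (@code_eltK gT)) (can_inj f'K).
Qed.

Lemma pv_subgroup (gT rT : finGroupType) (f : {multiplicative gT -> rT}) :
  injective f -> H (group_code rT) -> H (group_code gT).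
Proof.
move=> f_inj.
pose F : {multiplicative group_code gT -> group_code rT} :=
  @code_elt rT \o f \o @code_val gT.
apply: (pv_sub pvH (f := F)).
exact: inj_comp (can_inj (@code_eltK rT)) (inj_comp f_inj (can_inj (@code_valK gT))).
Qed.

Lemma pv_quotient (gT rT : finGroupType) (f : {multiplicative gT -> rT}) :
  (forall y, exists x, f x = y) -> H (group_code gT) -> H (group_code rT).
Proof.
move=> f_surj.
pose F : {multiplicative group_code gT -> group_code rT} :=
  @code_elt rT \o f \o @code_val gT.
apply: (pv_quo pvH (f := F)); apply/seteqP; split=> y // _.
have [x fx] := f_surj (code_val y); exists (code_elt x) => //=.
by rewrite code_eltK fx code_valK.
Qed.

Lemma pv_group_prod (gT rT : finGroupType) :
  H (group_code gT) -> H (group_code rT) -> H (group_code (gT * rT)%type).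
Proof.
move=> HgT HrT.
pose f (x : group_code (gT * rT)%type) :=
  (code_elt (code_val x).1, code_elt (code_val x).2).
have fM : {morph f : x y / x * y >-> x * y}.
  by move=> x y; rewrite /f !gmulfM.
apply: (pv_prod pvH (f := mult_map fM)) HgT HrT.
exists (fun z => code_elt (code_val z.1, code_val z.2)) => [x|[y z]].
  by rewrite /= /f !code_eltK -surjective_pairing code_valK.
by rewrite /= /f !code_eltK !code_valK.
Qed.

(** A pseudoword over H can be evaluated inside the subgroup generated by the
    letters, which is again in H. *)
Lemma group_eval_gen_mem (A : finType) (gT : finGroupType)
    (HgT : H (group_code gT)) (g : A -> gT) (u : proV A H) :
  group_eval HgT g u \in <<g @: [set: A]%SET>>.
Proof.
pose K := generated_group (g @: [set: A]%SET).
have sM : {morph (@sgval gT K) : x y / x * y >-> x * y} by [].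
have HK : H (group_code (subg_of K)).
  exact: (pv_subgroup (f := mult_map sM)) (@subg_inj _ _) HgT.
rewrite -(@group_eval_hom _ _ _ _ HK HgT (mult_map sM) (fun a => subg K (g a))).
  exact: subgP.
by move=> a /=; rewrite subgK // mem_gen // imset_f.
Qed.

End GroupsOfPseudovariety.

Lemma card_abelian_gen (gT : finGroupType) (M : nat) (s : seq gT) :
  commutative (@mulg gT) -> (forall x : gT, (#[x] <= M)%N) ->
  (#|<<[set x in s]%SET>>| <= M ^ size s)%N.
Proof.
move=> cT ordM; elim: s => [|x s IHs] /=.
  by rewrite finset.set_nil gen0 cards1.
rewrite finset.set_cons -joingE -joing_idl -joing_idr.
rewrite cent_joinEr; last by apply/centsP => y _ z _; exact: cT.
apply: leq_trans (_ : #[x] * #|<<[set y in s]%SET>>| <= _)%N; last first.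
  by rewrite expnS leq_mul.
by rewrite /order mul_cardG leq_pmulr // cardG_gt0.
Qed.

(** Bounded exponent bounds the size of the subgroup generated by the image of A
    in an abelian group.  An evaluation for which this subgroup is largest is
    injective on the free pro-H semigroup: pairing it with another evaluation
    does not increase the subgroup, so the other one factors through it. *)
Lemma bounded_locally_finite (H : set finSemigroupType) (M : nat) :
  pseudovariety H -> H `<=` pvAb ->
  (forall (gT : finGroupType) (g : gT), H (group_code gT) -> (#[g] <= M)%N) ->
  locally_finite H.
Proof.
move=> pvH HAb HM A.
have cH (gT : finGroupType) : H (group_code gT) -> commutative (@mulg gT).
  by move=> /HAb /pvAb_abelian; apply; exact: isog_to_group_code.
pose rank (gT : finGroupType) (g : A -> gT) := #|<<g @: [set: A]%SET>>|.
pose isrank n := `[< exists (gT : finGroupType) (g : A -> gT),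
    H (group_code gT) /\ rank gT g = n >].
have rank_ub n : isrank n -> (n <= M ^ #|A|)%N.
  move=> /asboolP[gT [g [HgT <-]]].
  rewrite /rank; have -> : g @: [set: A]%SET = [set x in codom g]%SET.
    apply/setP => x; rewrite inE; apply/imsetP/codomP => [[a _ ->]|[a ->]].
      by exists a.
    by exists a.
  by rewrite -(size_codom g) card_abelian_gen //; [exact: cH|move=> x; exact: HM].
have rank_ex : exists n, isrank n.
  have [S HS] := pv_nonempty pvH; have [gT gTS _] := HAb _ HS.
  exists (rank gT (fun=> 1)); apply/asboolP; exists gT, (fun=> 1); split=> //.
  exact: pv_isog HS gTS.
have [_ /asboolP[gT [g [HgT <-]]] g_max] := ex_maxnP rank_ex rank_ub.
suff inj : injective (group_eval HgT g).
  rewrite -(preimage_setT (group_eval HgT g)).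
  by apply: finite_preimage (finite_finset (X := setT)) => u v _ _; exact: inj.
move=> u v uv; apply: proV_eq => j.
have [rT [h [h' hK h'K]] _] := HAb _ (lab_in j).
have HrT : H (group_code rT).
  by apply: pv_isog (lab_in j) _ => //; exists h; exists h'.
pose g' a := h' (lab j a).
have evj (w : proV A H) : w j = h (group_eval HrT g' w).
  pose F : {multiplicative group_code rT -> j} := h \o @code_val rT.
  rewrite -[RHS]/(F _); apply/esym/(@proV_compat _ _ w (group_index HrT g') j F).
  by apply/funext => a /=; rewrite code_eltK h'K.
rewrite !evj; congr (h _).
have HP := pv_group_prod pvH HgT HrT.
pose gP a := (g a, g' a).
have ev1 (w : proV A H) : (group_eval HP gP w).1 = group_eval HgT g w.
  exact: (group_eval_hom HP HgT (f := fst)).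
have ev2 (w : proV A H) : (group_eval HP gP w).2 = group_eval HrT g' w.
  exact: (group_eval_hom HP HrT (f := snd)).
rewrite -!ev2; congr snd.
set K := <<gP @: [set: A]%SET>>.
have K_mem (w : proV A H) : group_eval HP gP w \in K by exact: group_eval_gen_mem.
suff /imset_injP : #|fst @: K| == #|K|.
  by apply; rewrite ?K_mem // !ev1.
rewrite eqn_leq leq_imset_card /=.
apply: leq_trans (g_max #|K| _) _.
  by apply/asboolP; exists _, gP.
apply: subset_leq_card.
have -> : fst @: K = fst_morphism gT rT @* K.
  by rewrite morphimEsub ?finset.subsetT.
rewrite morphim_gen ?finset.subsetT // gen_subG.
apply/fintype.subsetP => _ /imsetP[a _ ->].
by rewrite mem_gen //; apply/morphimP; exists (gP a); rewrite ?inE // imset_f.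
Qed.

(** If all prime powers divide orders of elements of H, then H contains all cyclic
    groups of prime power order.  Let K be a largest subgroup lying in H of an
    abelian group.  For a subgroup C in H, the join of C and K is a quotient of
    the direct product, hence also in H, and C lies in K; so K contains all
    elements of prime power order, and is the whole group. *)
Lemma full_torsion_pvAb (H : set finSemigroupType) :
  pseudovariety H -> H `<=` pvAb ->
  (forall r k, prime r -> exists (gT : finGroupType) (h : gT),
     H (group_code gT) /\ (r ^ k.+1 %| #[h])%N) ->
  pvAb `<=` H.
Proof.
move=> pvH HAb H_ord S [gT gTS cT]; apply: pv_isog_code gTS => //.
have cgT : commutative (@mulg gT).
  by move=> x y; apply: (centsP cT); exact: finset.in_setT.
pose inH (K : {group gT}) := `[< H (group_code (subg_of K)) >].
have [K /maxgroupP[/asboolP HK K_max]] : {K : {group gT} | maxgroup K inH}.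
  apply: ex_maxgroup; exists 1%G; apply/asboolP.
  have [S0 HS0] := pv_nonempty pvH; have [rT rTS0 _] := HAb _ HS0.
  pose f (x : subg_of (1%G : {group gT})) : rT := 1.
  have fM : {morph f : x y / x * y >-> x * y} by move=> x y; rewrite /f mulg1.
  apply: (pv_subgroup pvH (f := mult_map fM)) (pv_isog pvH HS0 rTS0).
  by move=> x y _; apply: val_inj; rewrite (set1P (valP x)) (set1P (valP y)).
have K_join (C : {group gT}) : H (group_code (subg_of C)) -> C \subset K.
  move=> HC; rewrite -(K_max (C <*> K)%G) ?joing_subl ?joing_subr //.
  apply/asboolP.
  pose f (z : subg_of C * subg_of K) := subg (C <*> K)%G (sgval z.1 * sgval z.2).
  have f_mem (z : subg_of C * subg_of K) : sgval z.1 * sgval z.2 \in (C <*> K)%G.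
    apply: groupM; first exact: fintype.subsetP (joing_subl C K) _ (subgP _).
    exact: fintype.subsetP (joing_subr C K) _ (subgP _).
  have fM : {morph f : x y / x * y >-> x * y}.
    move=> x y; apply: val_inj; rewrite /= !subgK ?f_mem //= ?groupM ?f_mem //.
    by rewrite -!mulgA; congr (_ * _); rewrite !mulgA [X in X * _]cgT.
  apply: (pv_quotient pvH (f := mult_map fM)) (pv_group_prod pvH HC HK).
  move=> y; have := subgP y; rewrite /= cent_joinEr; last first.
    by apply/centsP => z _ t _; exact: cgT.
  case/mulsgP=> c k Cc Kk yck; exists (subg C c, subg K k).
  by apply: val_inj; rewrite /= !subgK // ?yck // -yck subgP.
have K_primary r (g : gT) : prime r -> r.-elt g -> g \in K.
  move=> r_pr /p_natP[[|k] g_ord].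
    by have /eqP -> : g == 1 by rewrite -order_eq1 g_ord.
  have [rT [h [HrT]]] := H_ord r k r_pr; rewrite -g_ord => g_h.
  have : <[g]> \isog <[h ^+ (#[h] %/ #[g])]>.
    rewrite isog_cyclic_card ?cycle_cyclic // -!orderE orderXdiv ?dvdn_div //.
    by rewrite -[X in (X %/ _)%N](divnK g_h) mulKn ?eqxx // divn_gt0 // dvdn_leq.
  case/isogP=> f f_inj _.
  rewrite -cycle_subG; apply: K_join.
  pose f' (x : subg_of <[g]>%G) := f (sgval x).
  have f'M : {morph f' : x y / x * y >-> x * y}.
    by move=> x y; rewrite /f' -morphM ?subgP.
  apply: (pv_subgroup pvH (f := mult_map f'M)) HrT => x y fxy.
  by apply: val_inj; apply: (injmP f_inj); rewrite ?subgP.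
have KT (g : gT) : g \in K.
  rewrite -(prod_constt g); apply: group_prod => r _.
  have [r_pr|r_npr] := boolP (prime r).
    by apply: K_primary r_pr _; exact: p_elt_constt.
  suff /eqP -> : g.`_r == 1 by [].
  rewrite -order_eq1; apply: contraNT r_npr => g_r.
  have o_gt1 : (1 < #[g.`_r])%N by rewrite ltn_neqAle eq_sym g_r order_gt0.
  have := pnatPpi (p_elt_constt r g) (etrans (pi_pdiv _) o_gt1).
  by rewrite inE => /eqP <-; exact: pdiv_prime.
have sM : {morph subg K : x y / x * y >-> x * y}.
  by move=> x y; apply: val_inj; rewrite /= !subgK.
apply: (pv_subgroup pvH (f := mult_map sM)) HK => x y /(congr1 val).
by rewrite /= !subgK.
Qed.

Lemma abelian_not_kappa_reducible (H : set finSemigroupType) :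
  pseudovariety H -> H `<` pvAb -> ~ locally_finite H ->
  ~ completely_kappa_reducible (DRH H).
Proof.
move=> pvH [HAb AbH] nlf.
have [r [k [r_pr H_r]]] : exists r k, prime r /\
    forall (gT : finGroupType) (h : gT), H (group_code gT) -> ~~ (r ^ k.+1 %| #[h])%N.
  apply: contrapT => no_rk; apply: AbH; apply: full_torsion_pvAb => // r k r_pr.
  apply: contrapT => no_h; apply: no_rk; exists r, k; split=> // gT h HgT.
  by apply/negP => rh; apply: no_h; exists gT, h.
apply: (root_not_kappa_reducible r_pr) => [gT G g HG gTG|M].
  exact: H_r (pv_isog pvH HG gTG).
apply: contrapT => bounded; apply: nlf.
apply: (bounded_locally_finite (M := M)) => // gT g HgT.
by rewrite leqNgt; apply/negP => gM; apply: bounded; exists gT, g.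
Qed.

Lemma pvGp_not_kappa_reducible (p : nat) :
  prime p -> ~ completely_kappa_reducible (DRH (pvGp p)).
Proof.
move=> p_pr; pose r := if p == 2%N then 3%N else 2%N.
have r_pr : prime r by rewrite /r; case: ifP.
have r_p : r != p by rewrite /r; case: (eqVneq p 2%N) => [->|]; rewrite // eq_sym.
apply: (root_not_kappa_reducible (k := 0%N) r_pr) => [gT G g [rT rTG pT] gTG|M].
  apply/negP; rewrite expn1 => r_g; case/negP: r_p.
  have /pgroupP/(_ r r_pr) : p.-group [set: gT]%SET.
    by rewrite /pgroup cardsT (isog_to_card gTG) -(isog_to_card rTG) -cardsT.
  by apply; apply: dvdn_trans r_g _; rewrite order_dvdG ?finset.in_setT.
have p_gt0 := prime_gt0 p_pr.
exists 'I_((p ^ M.+1).-1.+1), Zp1.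
rewrite order_Zp1 prednK ?expn_gt0 ?p_gt0 //; split; last first.
  exact: ltn_trans (ltnSn _) (ltn_expl _ (prime_gt1 p_pr)).
exists 'I_((p ^ M.+1).-1.+1); first exact: isog_to_group_code.
by rewrite /pgroup cardsT card_ord prednK ?expn_gt0 ?p_gt0 // pnatX pnat_id.
Qed.

(** * Affine maps modulo odd numbers *)

Section AffineGenerators.
Variable k : nat.
Notation Z := 'I_(k.*2.+1.+2).

Fact dilation_inj : injective (fun z : Z => (2%:R * z)%R).
Proof.
(* k + 2 is the inverse of 2 modulo 2k + 3 *)
have inv2 : ((k.+2)%:R * 2%:R = 1 :> Z)%R.
  rewrite -natrM (_ : (k.+2 * 2)%N = (k.*2.+1.+2).+1); last by rewrite muln2.
  by rewrite -natr1 (@pchar_Zp k.*2.+1.+2) ?add0r.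
by apply: (can_inj (g := fun z => (k.+2%:R * z)%R)) => z; rewrite mulrA inv2 mul1r.
Qed.

Fact succ_inj : injective (fun z : Z => (z + 1)%R).
Proof. exact: addIr. Qed.

Definition affine_gen (b : bool) : {perm Z} :=
  if b then perm dilation_inj else perm succ_inj.

End AffineGenerators.

Lemma intr_odd_eq0 (m : int) :
  (forall k, m%:~R = 0 :> 'I_(k.*2.+1.+2))%R -> m = 0%R.
Proof.
have nat_eq0 (n : nat) : (n%:R = 0 :> 'I_(n.*2.+1.+2))%R -> n = 0%N.
  move/(congr1 (@nat_of_ord _)); rewrite (@val_Zp_nat n.*2.+1.+2) //= modn_small //.
  by rewrite ltnS -addnn; do 2 apply: leqW; exact: leq_addr.
case: m => n m0; first by rewrite (nat_eq0 n (m0 n)).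
have := m0 n.+1; rewrite NegzE mulrNz => /eqP; rewrite oppr_eq0 => /eqP.
by move/nat_eq0.
Qed.

(** A kappa-word acts as z |-> 2^(d - c) z + m / 2^c, with the same c, d and m for
    all moduli. *)
Lemma kappa_word_affine (u : pseudoword bool) : kappa_word u ->
  exists c d (m : int), forall k (z : 'I_(k.*2.+1.+2)),
    (2%:R ^+ c * pseudo_eval (affine_gen k) u z = 2%:R ^+ d * z + m%:~R)%R.
Proof.
elim=> [[]|{}u v _ [c [d [m um]]] _ [c' [d' [m' vm]]]|{}u v _ [c [d [m um]]] uv].
- exists 0%N, 1%N, 0%R => k z; rewrite group_eval_gen permE.
  by rewrite mul1r addr0.
- exists 0%N, 0%N, 1%R => k z; rewrite group_eval_gen permE.
  by rewrite !mul1r.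
- exists (c + c')%N, (d + d')%N, (2%:R ^+ d' * m + 2%:R ^+ c * m')%R => k z.
  rewrite group_evalM permM exprD -mulrA vm mulrDr mulrCA um.
  rewrite intrD !intrM !rmorphXn /= !rmorph_nat exprD.
  by move: (2%:R ^+ c)%R (2%:R ^+ d)%R (2%:R ^+ d')%R => *; ring.
exists d, c, (- m)%R => k z; rewrite (group_eval_pred _ uv).
set w := pseudo_eval _ _.
have := um k ((w^-1)%g z); rewrite permKV => ->.
by rewrite mulrNz addrK.
Qed.

(** Comparing slopes in x y x = y gives c = d, so that x is a translation, by m/2^c;
    comparing constant terms then gives (2^(c + f) + 2^(e + c)) m = 0, and m is
    zero since it vanishes modulo all odd numbers. *)
Lemma kappa_word_inverted_trivial (x y : pseudoword bool) :
  kappa_word x -> kappa_word y ->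
  (forall k, pseudo_eval (affine_gen k) (x * y * x) =
     pseudo_eval (affine_gen k) y) ->
  pseudo_eval (affine_gen 0) x = 1.
Proof.
move=> /kappa_word_affine[c [d [m xm]]] /kappa_word_affine[e [f [n yn]]] xyx.
have eqn k (z : 'I_(k.*2.+1.+2)) :
  (2%:R ^+ (c + c) * (2%:R ^+ f * z + n%:~R) =
   2%:R ^+ (d + f) * (2%:R ^+ d * z + m%:~R) + 2%:R ^+ (c + d) * n%:~R
   + 2%:R ^+ (e + c) * m%:~R)%R.
  have := congr1 (fun s : {perm _} => s z) (xyx k).
  rewrite !group_evalM !permM => xyxz.
  set X := pseudo_eval _ x in xyxz; set Y := pseudo_eval _ y in xyxz.
  have h1 := xm k (Y (X z)); rewrite xyxz in h1.
  have h2 := yn k (X z); have h3 := xm k z; have h4 := yn k z.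
  rewrite -/X -/Y in h1 h2 h3 h4.
  rewrite -h4 !exprD.
  move: (2%:R ^+ c)%R (2%:R ^+ d)%R (2%:R ^+ e)%R (2%:R ^+ f)%R h1 h2 h3 h4
    => C D E F h1 h2 h3 h4.
  transitivity (C * E * (C * Y z))%R; first by ring.
  rewrite h1.
  transitivity (C * D * (E * Y (X z)) + C * E * m%:~R)%R; first by ring.
  rewrite h2.
  transitivity (D * F * (C * X z) + C * D * n%:~R + C * E * m%:~R)%R;
    first by ring.
  by rewrite h3; ring.
have cd : c = d.
  have /intr_odd_eq0/subr0_eq : forall k,
      ((2%:R ^+ (c + c + f) - 2%:R ^+ (d + d + f))%:~R = 0 :> 'I_(k.*2.+1.+2))%R.
    move=> k; rewrite intrB !rmorphXn /= !rmorph_nat.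
    apply/eqP; rewrite subr_eq0; apply/eqP.
    have := eqn k 1%R; have := eqn k 0%R; rewrite !mulr0 !add0r !mulr1 => e0 e1.
    apply: (addIr (2%:R ^+ (c + c) * n%:~R)%R).
    transitivity (2%:R ^+ (c + c) * (2%:R ^+ f + n%:~R) : 'I_(k.*2.+1.+2))%R;
      first by rewrite exprD mulrDr.
    rewrite e1 e0 !exprD.
    by move: (2%:R ^+ c)%R (2%:R ^+ d)%R (2%:R ^+ e)%R (2%:R ^+ f)%R => *; ring.
  move/(ieexprIn (isT : (0 < 2%:R :> int)%R) isT)/eqP.
  by rewrite eqn_add2r !addnn => /eqP/double_inj.
have m0 : m = 0%R.
  have /intr_odd_eq0/eqP : forall k,
      (((2%:R ^+ (c + f) + 2%:R ^+ (e + c)) * m)%:~R = 0 :> 'I_(k.*2.+1.+2))%R.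
    move=> k; rewrite intrM intrD !rmorphXn /= !rmorph_nat.
    have := eqn k 0%R; rewrite -cd !mulr0 !add0r => e0.
    apply: (addrI (2%:R ^+ (c + c) * n%:~R)%R); rewrite addr0 [RHS]e0 !exprD.
    by move: (2%:R ^+ c)%R (2%:R ^+ e)%R (2%:R ^+ f)%R => *; ring.
  rewrite mulf_eq0 => /orP[|/eqP //]; rewrite (negPf (lt0r_neq0 _)) //.
  by rewrite addr_gt0 // exprn_gt0.
apply/permP => z; rewrite perm1.
have := xm 0%N z; rewrite cd m0 addr0.
by elim: (d) => [|i IHi]; rewrite ?mul1r // !exprS -!mulrA => /dilation_inj.
Qed.

(** * Inversion: an equation over two letters *)

(** The 3-cycle [gen3 false] of Sym(Z/3) and the transposition [gen3 true]
    inverting it. *)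
Notation gen3 := (affine_gen 0).

(** As e starts with the word ab, both e a and e a b are R-equivalent to e.  The
    element e b is then obtained in the group as (e a)^-1 (e a b). *)
Lemma DRH_two_letters (H : set finSemigroupType) (i : labelled bool (DRH H))
    (e z : i) :
  e * e = e -> e = lab i true * lab i false * z ->
  exists (gT : finGroupType) (F : {multiplicative gT -> i}) (g : bool -> gT),
    F 1 = e /\ forall a, F (g a) = e * lab i a.
Proof.
move=> ee ez; have [gT [F [_ F_inj F1 FR]]] := DRH_group (lab_in i) ee.
have [|g1 Fg1] := FR (lab i true) (lab i false * z).
  by rewrite -mulgA (mulgA (lab i true)) -ez ee.
have [|g2 Fg2] := FR (lab i true * lab i false) z; first by rewrite -mulgA -ez ee.
exists gT, F, (fun a : bool => if a then g1 else g1^-1 * g2); split=> // -[] //.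
by rewrite gmulfM Fg2 (mulgA e) mulgA -Fg1 -gmulfM mulVg F1.
Qed.

(** One finite group that covers Sym(Z/3) and decides, for the given members of
    DRG, the equality of words after translation by e. *)
Lemma common_group (e : pseudoword bool)
    (L : seq {classic labelled bool (DRH pvG)}) :
  idempotent_right_multiple e (gen _ true * gen _ false) ->
  exists (gT : finGroupType) (g : bool -> gT)
    (chi : {multiplicative gT -> {perm 'I_3}}),
    (forall a, chi (g a) = gen3 a) /\
    forall i : labelled bool (DRH pvG), (i : {classic _}) \in L ->
    forall u v : pseudoword bool, letter_word u -> letter_word v ->
    pseudo_eval g u = pseudo_eval g v ->
    e (forget_in i) * u (forget_in i) = e (forget_in i) * v (forget_in i).
Proof.
move=> eP; elim: L => [|j L [gT [g [chi [chig gL]]]]].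
  by exists {perm 'I_3}, gen3, idfun.
have [ee [z ez]] := eP (forget_in j).
have [rT [F [h [F1 Fh]]]] := DRH_two_letters ee ez.
exists (gT * rT)%type, (fun a => (g a, h a)), (chi \o fst); split=> // i.
have ev1 (w : pseudoword bool) :
    (pseudo_eval (fun a => (g a, h a)) w).1 = pseudo_eval g w.
  exact: (group_eval_hom _ _ (f := fst)).
have ev2 (w : pseudoword bool) :
    (pseudo_eval (fun a => (g a, h a)) w).2 = pseudo_eval h w.
  exact: (group_eval_hom _ _ (f := snd)).
rewrite inE => /orP[/eqP ->|/gL iL] u v uw vw uv; last first.
  by apply: iL => //; rewrite -!ev1 uv.
have Fev := @translation_eval _ (forget_in j) _ F h.
rewrite -F1 in Fh *.
by rewrite -!(Fev Fh) // -!ev2 uv.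
Qed.

(** The elements of gT that are values of words form a subgroup, which maps onto
    Sym(Z/3); there the pair (s, t) lifts. *)
Lemma letter_word_lift (gT : finGroupType) (g : bool -> gT)
    (chi : {multiplicative gT -> {perm 'I_3}}) :
  (forall a, chi (g a) = gen3 a) ->
  exists x y : pseudoword bool, [/\ letter_word x, letter_word y,
    pseudo_eval gen3 x = gen3 false &
    pseudo_eval g (x * y * x) = pseudo_eval g y].
Proof.
move=> chig.
have gen3E (a : bool) (z : 'I_3) :
    gen3 a z = if a then (2%:R * z)%R else (z + 1)%R.
  by case: a; rewrite permE.
have s3 : gen3 false ^+ 3 = 1.
  apply/permP => z; rewrite !expgS expg0 !permM !gen3E !perm1.
  by case: z => [[|[|[|]]]] // ?; exact: val_inj.
have t2 : gen3 true ^+ 2 = 1.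
  apply/permP => z; rewrite !expgS expg0 !permM !gen3E !perm1.
  by case: z => [[|[|[|]]]] // ?; exact: val_inj.
have st : gen3 false * gen3 true * gen3 false = gen3 true.
  apply/permP => z; rewrite !permM !gen3E.
  by case: z => [[|[|[|]]]] // ?; exact: val_inj.
pose G := [set x | `[< exists2 u : pseudoword bool,
                        letter_word u & pseudo_eval g u = x >]]%SET.
have GP x : reflect (exists2 u : pseudoword bool,
    letter_word u & pseudo_eval g u = x) (x \in G).
  by rewrite inE; exact: asboolP.
have gen_word a := letter_word_gen [set: finSemigroupType] (a : bool).
have groupG : group_set G.
  apply/group_setP; split=> [|x y /GP[u uw <-] /GP[v vw <-]]; apply/GP.
    (* the empty word is not available: 1 is a power of a letter *)
    exists (spow (gen _ true) #[g true].-1); first exact: letter_word_spow.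
    by rewrite group_eval_spow group_eval_gen prednK ?expg_order.
  by exists (u * v); [exact: letter_word_mul|rewrite group_evalM].
have chiM : {in Group groupG &, {morph chi : x y / x * y}}.
  by move=> x y _ _; exact: gmulfM.
have genG a : gen3 a \in Morphism chiM @* Group groupG.
  rewrite -chig; apply: (mem_morphim (Morphism chiM)); apply/GP;
  by exists (gen _ a); rewrite ?group_eval_gen.
have [x [y [/GP[u uw ux] /GP[v vw vy] chix chiy xy]]] :
    exists x y, [/\ x \in G, y \in G, chi x = gen3 false, chi y = gen3 true &
      x ^ y = x^-1].
  apply: (@lift_inversion _ _ _ (Morphism chiM) 3); rewrite ?genG //.
  - by apply: (@pnat_dvd _ 3); rewrite ?order_dvdn ?s3.
  - by apply: (@pnat_dvd _ 2); rewrite ?order_dvdn ?t2.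
  apply: (mulgI (gen3 true)); rewrite -conjgC.
  by apply: (mulIg (gen3 false)); rewrite mulgKV.
exists u, v; split=> //.
  by rewrite -chix -ux; apply/esym; exact: group_eval_hom.
by rewrite !group_evalM ux vy (conjgC x y) xy mulgKV.
Qed.

Lemma DRG_inversion_solution (e : pseudoword bool) :
  idempotent_right_multiple e (gen _ true * gen _ false) ->
  exists x y : pseudoword bool, pseudo_eval gen3 x = gen3 false /\
    eq_mod (DRH pvG) (e * (x * y * x)) (e * y).
Proof.
move=> eP.
(* None stands for the constraint on x, Some i for the equation at i. *)
pose I := option (labelled bool (DRH pvG)).
pose c (o : I) : labelled bool [set: finSemigroupType] :=
  if o is Some i then forget_in i else pseudo_index gen3.
pose Pr (o : I) : (bool -> c o) -> Prop :=
  match o with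
  | Some i => fun w => e (forget_in i) * (w true * w false * w true) =
                       e (forget_in i) * w false
  | None => fun w => code_val (w true) = gen3 false
  end.
have [w wP] : exists w : bool -> pseudoword bool,
    forall o : I, Pr o (fun a => w a (c o)).
  apply: (@proV_compactness _ _ _ _ c Pr) => L.
  have [L' LL'] : exists L' : seq {classic labelled bool (DRH pvG)},
      forall i, (Some i : {classic I}) \in L -> (i : {classic _}) \in L'.
    elim: L => [|[j|] L [L' LL']]; first by exists [::].
      exists ((j : {classic _}) :: L') => i; rewrite !inE.
      by case/orP=> [/eqP[->]|/LL' ->]; rewrite ?eqxx ?orbT.
    by exists L' => i; rewrite inE => /orP[/eqP|/LL'].
  have [gT [g [chi [chig gL]]]] := common_group L' eP.
  have [x [y [xw yw x3 xy]]] := letter_word_lift chig.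
  exists (fun a => if a then x else y) => -[i|] iL //=.
  apply: (gL i _ (x * y * x) y) => //; first exact: LL'.
  by do !apply: letter_word_mul.
exists (w true), (w false); split; first exact: (wP None).
by apply: proV_eq => i; exact: (wP (Some i)).
Qed.

Lemma pvG_not_kappa_reducible : ~ completely_kappa_reducible (DRH pvG).
Proof.
move=> red.
have [e eP] := idempotent_multiple (gen [set: finSemigroupType] true * gen _ false).
have [x [y [x3 xy]]] := DRG_inversion_solution eP.
pose Y := (option bool + void)%type.
pose w (t : Y) := match t with
  | inl None => e | inl (Some true) => x | inl (Some false) => y
  | inr p => of_void _ p end.
pose yg (t : option bool) : pseudoword Y := gen _ (inl t).
pose u := yg None * (yg (Some true) * yg (Some false) * yg (Some true)).
pose v := yg None * yg (Some false).
have ku : kappa_word u by do !apply: kappa_mul; exact: kappa_gen.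
have kv : kappa_word v by do !apply: kappa_mul; exact: kappa_gen.
have kw p : kappa_word (w (inr p)) by case: p.
have wuv : eq_mod (DRH pvG) (subst w u) (subst w v).
  by rewrite /u /v !substM !subst_gen; exact: xy.
have [delta [kd d3 _]] := kappa_solution (pseudo_index gen3) red ku kv kw wuv.
rewrite /u /v !gmulfM.
set X := delta (yg (Some true)); set Z := delta (yg (Some false)) => XZ.
have /permP/(_ 0%R) : pseudo_eval gen3 X = 1.
  apply: (kappa_word_inverted_trivial (y := Z)); [exact: kd|exact: kd|move=> k].
  apply: (mulgI (pseudo_eval (affine_gen k) (delta (yg None)))).
  rewrite -!group_evalM; apply: eq_mod_group XZ.
  by eexists; exact: isog_to_group_code.
have -> : pseudo_eval gen3 X = gen3 false.
  by rewrite -x3 /group_eval; congr code_val; exact: d3.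
by rewrite permE perm1 => /(congr1 (@nat_of_ord _)).
Qed.

Theorem corollary8p2 (H : set finSemigroupType) :
  [\/ [/\ pseudovariety H, H `<` pvAb & ~ locally_finite H],
      H = pvG |
      exists2 p : nat, prime p & H = pvGp p] ->
  ~ completely_kappa_reducible (DRH H).
Proof.
case=> [[pvH HAb nlf]|->|[p p_pr ->]].
- exact: abelian_not_kappa_reducible.
- exact: pvG_not_kappa_reducible.
- exact: pvGp_not_kappa_reducible.
Qed.
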